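(* Let $m$, $n$ and $q$ be positive integers such that $mnq$ is even. Then \[ \sum_{k = 1}^\infty \frac{F_{nk+mnq}}{\prod_{j=0}^{2m} L_{nk+jnq}} = \frac{1}{5F_{mnq}}\sum_{k=1}^{q}\prod_{j=0}^{2m-1}\frac{1}{L_{nk+jnq}}. \]
   Context: The Fibonacci numbers are defined by $F_0=0$, $F_1=1$, $F_n=F_{n-1}+F_{n-2}$, and the Lucas numbers by $L_0=2$, $L_1=1$, $L_n=L_{n-1}+L_{n-2}$. Infinite sums are limits of partial sums. *)

(* Defs.v *)
From mathcomp Require Import all_boot.

Set Implicit Arguments.
Unset Strict Implicit.
Unset Printing Implicit Defensive.

Fixpoint fib (n : nat) : nat :=
  match n with
  | 0 => 0
  | 1 => 1
  | (n'.+1 as p).+1 => fib p + fib n'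
  end.

Fixpoint lucas (n : nat) : nat :=
  match n with
  | 0 => 2
  | 1 => 1
  | (n'.+1 as p).+1 => lucas p + lucas n'
  end.

(* Main.v *)
(* With s = mnq even, L_(nk+2s) - L_(nk) = 5 F_s F_(nk+s), so the k-th term is
   (g k - g (k+q)) / (5 F_s) with g k the product of the 1/L_(nk+jnq), j < 2m:
   dropping the factor j = 0 from the product over j <= 2m shifts k by q.  The
   series telescopes because g tends to 0. *)
Require Import Defs.
From mathcomp Require Import all_boot all_order all_algebra.
From mathcomp Require Import all_classical all_reals all_analysis.
From mathcomp Require Import ring zify.
Import Order.TTheory GRing.Theory Num.Theory.
Import numFieldNormedType.Exports.
Local Open Scope classical_set_scope.
Local Open Scope ring_scope.

Lemma fibSS (n : nat) : fib n.+2 = (fib n.+1 + fib n)%N.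
Proof. by []. Qed.

Lemma lucasSS (n : nat) : lucas n.+2 = (lucas n.+1 + lucas n)%N.
Proof. by []. Qed.

Lemma fib_gt0 (n : nat) : (0 < n)%N -> (0 < fib n)%N.
Proof.
elim/ltn_ind: n => -[|[|n]] // IH _.
by rewrite fibSS addn_gt0 IH.
Qed.

Lemma lucas_gt0 (n : nat) : (0 < lucas n)%N.
Proof.
elim/ltn_ind: n => -[|[|n]] // IH.
by rewrite lucasSS addn_gt0 IH.
Qed.

Lemma leq_lucas (n : nat) : (n <= lucas n)%N.
Proof.
elim: n => [|[|n] IH] //.
by rewrite lucasSS -addn1 leq_add ?lucas_gt0.
Qed.

(** Used as $L_n = 2F_{n+1} - F_n$; the additive form avoids truncated subtraction on [nat]. *)
Lemma lucasE (n : nat) : (lucas n + fib n = 2 * fib n.+1)%N.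
Proof.
elim/ltn_ind: n => -[|[|n]] // IH.
have := IH n (leqnSn _); have := IH n.+1 (leqnn _).
rewrite lucasSS !fibSS; lia.
Qed.

Lemma fibDS (m n : nat) :
  fib (m + n).+1 = (fib m.+1 * fib n.+1 + fib m * fib n)%N.
Proof.
elim: n m => [|n IH] m; first by rewrite addn0 muln1 muln0 addn0.
rewrite addnS -addSn IH !fibSS; ring.
Qed.

(** The usual $F_m F_{n-1} + F_{m+1} F_n$ with $F_{n-1} = F_{n+1} - F_n$ substituted, so that only
    indices $m, m+1, n, n+1$ occur. *)
Lemma fibD (m n : nat) :
  (fib (m + n) + fib m * fib n = fib m * fib n.+1 + fib m.+1 * fib n)%N.
Proof.
case: n => [|n]; first by rewrite addn0 !muln0 muln1 !addn0.
rewrite addnS fibDS fibSS; ring.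
Qed.

(** Cassini's identity without $F_{n-1}$. Induction in steps of two stays within the even indices,
    where the sign $(-1)^n$ is $1$. *)
Lemma cassini_even (n : nat) : ~~ odd n ->
  (fib n.+1 * fib n.+1 = fib n * fib n.+1 + fib n * fib n + 1)%N.
Proof.
elim/ltn_ind: n => -[|[|n]] // IH.
rewrite /= negbK => /IH -/(_ (leqnSn _)).
rewrite -/(fib n.+1) -/(fib n.+2) -/(fib n.+3) !fibSS; nia.
Qed.

(** Everything is expanded into $F_s, F_{s+1}, F_a, F_{a+1}$; what remains is a multiple of
    Cassini's relation for $s$. *)
Lemma lucas_add_double (R : comNzRingType) (a s : nat) : ~~ odd s ->
  (lucas (a + s + s))%:R - (lucas a)%:R
  = 5 * (fib (a + s))%:R * (fib s)%:R :> R.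
Proof.
have lucasR n : (lucas n)%:R = 2 * (fib n.+1)%:R - (fib n)%:R :> R.
  by apply/(canRL (addrK _)); rewrite -natrD lucasE natrM.
have fibR m n : (fib (m + n))%:R = (fib m)%:R * (fib n.+1)%:R
    + (fib m.+1)%:R * (fib n)%:R - (fib m)%:R * (fib n)%:R :> R.
  by apply/(canRL (addrK _)); rewrite -!natrM -!natrD fibD.
have fibSR m n : (fib (m + n).+1)%:R = (fib m.+1)%:R * (fib n.+1)%:R
    + (fib m)%:R * (fib n)%:R :> R.
  by rewrite fibDS natrD !natrM.
move=> /cassini_even/(congr1 (fun i : nat => i%:R : R)).
rewrite !lucasR !(fibSR, fibR) !natrD !natrM.
move: (fib s)%:R (fib s.+1)%:R (fib a)%:R (fib a.+1)%:R => x y u v cassini.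
(* The cofactor [2 * v - u] of Cassini's relation is $L_a$; the second summand is $5 F_{a+s}
   F_s$. *)
transitivity ((2 * v - u) * (y * y - (x * y + x * x + 1))
  + 5 * (u * y + v * x - u * x) * x); first by ring.
by rewrite cassini subrr mulr0 add0r.
Qed.

(** Telescoping with step $q$: the overlap cancels, leaving the first $q$ values and a window of $q$
    values starting after $N$. *)
Lemma sum_sub_shift (V : zmodType) (g : nat -> V) (q N : nat) :
  \sum_(1 <= k < N.+1) (g k - g (k + q)%N)
  = \sum_(1 <= k < q.+1) g k - \sum_(1 <= k < q.+1) g (k + N)%N.
Proof.
elim: N => [|N IH].
  by rewrite big_geq //; under [X in _ - X]eq_bigr do rewrite addn0; rewrite subrr.
rewrite big_nat_recr //= IH -addrA; congr (_ + _).
(* Sliding the window by one gains $g(q+1+N)$ and loses $g(1+N)$. *)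
have : \sum_(1 <= k < q.+1) g (k + N.+1)%N - \sum_(1 <= k < q.+1) g (k + N)%N
    = g (q.+1 + N)%N - g (1 + N)%N.
  rewrite -sumrB -(telescope_sumr (fun k => g (k + N)%N)) //.
  by apply: eq_bigr => k _; rewrite addnS.
move=> /(canRL (subrK _)) ->.
by rewrite opprD opprB addrC add1n addnC addSnnS.
Qed.

(** The factor $j = 0$ is at most $1/k$ for $k > 0$ because $L_i \ge i$; the other factors lie in
    $[0, 1]$. *)
Lemma prod_inv_lucas_cvg0 (R : realType) (m n d : nat) :
    (0 < m)%N -> (0 < n)%N ->
  (fun k => \prod_(0 <= j < m) (1 / (lucas (n * k + j * d))%:R) : R)
    @ \oo --> (0 : R).
Proof.
(* Passing to $k+1$ matches the harmonic sequence $1/(k+1)$ used as upper bound. *)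
move=> m_gt0 n_gt0; rewrite -cvg_shiftS.
apply: (squeeze_cvgr _ (cvg_cst 0) cvg_harmonic).
apply: nearW => k /=; apply/andP; split.
  by apply: prodr_ge0 => j _; rewrite divr_ge0.
rewrite big_ltn // mul0n addn0 /harmonic /= -[leRHS]mulr1.
have factor_ge0 j : 0 <= 1 / (lucas (n * k.+1 + j * d))%:R :> R.
  by rewrite divr_ge0.
apply: ler_pM; [by rewrite divr_ge0| by apply: prodr_ge0 | |].
  rewrite div1r lef_pV2 ?posrE ?ltr0n ?lucas_gt0 // ler_nat.
  exact: leq_trans (leq_pmull _ n_gt0) (leq_lucas _).
apply: prodr_ile1 => j _.
by rewrite factor_ge0 div1r invf_le1 ?ler1n ?ltr0n lucas_gt0.
Qed.

Lemma fib_div_prod_lucas (R : realType) (m n q k : nat) :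
    (0 < m)%N -> (0 < n)%N -> (0 < q)%N -> ~~ odd (m * n * q) ->
  (fib (n * k + m * n * q))%:R /
    \prod_(0 <= j < (2 * m).+1) (lucas (n * k + j * n * q))%:R
  = 1 / (5 * (fib (m * n * q))%:R) *
    (\prod_(0 <= j < 2 * m) (1 / (lucas (n * k + j * n * q))%:R)
     - \prod_(0 <= j < 2 * m) (1 / (lucas (n * (k + q) + j * n * q))%:R)) :> R.
Proof.
move=> m_gt0 n_gt0 q_gt0 even_mnq.
have lucas_neq0 i : (lucas i)%:R != 0 :> R by rewrite pnatr_eq0 -lt0n lucas_gt0.
have fib_neq0 : (fib (m * n * q))%:R != 0 :> R.
  by rewrite pnatr_eq0 -lt0n fib_gt0 ?muln_gt0 ?m_gt0 ?n_gt0.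
have prodE r : \prod_(0 <= j < 2 * m) (1 / (lucas (n * r + j * n * q))%:R)
    = (\prod_(0 <= j < 2 * m) (lucas (n * r + j * n * q))%:R)^-1 :> R.
  by rewrite -prodfV; apply: eq_bigr => j _; rewrite div1r.
(* Removing $j = 0$: $nk + (j+1)nq = n(k+q) + jnq$. *)
have splitl : \prod_(0 <= j < (2 * m).+1) (lucas (n * k + j * n * q))%:R
    = (lucas (n * k))%:R * \prod_(0 <= j < 2 * m) (lucas (n * (k + q) + j * n * q))%:R :> R.
  rewrite big_nat_recl //= mul0n addn0; congr (_ * _).
  by apply: eq_bigr => j _; congr (lucas _)%:R; ring.
(* Removing $j = 2m$: its index is $nk + 2mnq$, written as a double addition to fit
   [lucas_add_double]. *)
have splitr : \prod_(0 <= j < (2 * m).+1) (lucas (n * k + j * n * q))%:R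
    = \prod_(0 <= j < 2 * m) (lucas (n * k + j * n * q))%:R
      * (lucas (n * k + m * n * q + m * n * q))%:R :> R.
  by rewrite big_nat_recr //=; congr (_ * (lucas _)%:R); ring.
rewrite !prodE.
set P := \prod_(0 <= j < _.+1) _ in splitl splitr *.
have -> : (\prod_(0 <= j < 2 * m) (lucas (n * k + j * n * q))%:R)^-1
    = (lucas (n * k + m * n * q + m * n * q))%:R / P :> R.
  by rewrite splitr invfM mulrCA mulfV ?mulr1.
have -> : (\prod_(0 <= j < 2 * m) (lucas (n * (k + q) + j * n * q))%:R)^-1
    = (lucas (n * k))%:R / P :> R.
  by rewrite splitl invfM mulrA mulfV ?mul1r.
rewrite -mulrBl lucas_add_double // [RHS]mulrA; congr (_ / P).
by field; rewrite fib_neq0.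
Qed.

Theorem theorem2p22 (R : realType) (m n q : nat)
    (hm : (0 < m)%N) (hn : (0 < n)%N) (hq : (0 < q)%N)
    (heven : ~~ odd (m * n * q)) :
  (fun N : nat =>
     \sum_(1 <= k < N.+1)
        (fib (n * k + m * n * q))%:R /
        \prod_(0 <= j < (2 * m).+1) (lucas (n * k + j * n * q))%:R)
    @ \oo -->
  (1 / (5 * (fib (m * n * q))%:R) *
   \sum_(1 <= k < q.+1)
      \prod_(0 <= j < 2 * m) (1 / (lucas (n * k + j * n * q))%:R) : R).
Proof.
pose g k : R := \prod_(0 <= j < 2 * m) (1 / (lucas (n * k + j * n * q))%:R).
under eq_fun => N.
  under eq_bigr do rewrite fib_div_prod_lucas // -/(g _) -/(g _).
  rewrite -mulr_sumr sum_sub_shift; over.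
(* The sum of the first $q$ values is constant in $N$, so only the window has to tend to $0$. *)
apply: cvgMl_tmp; rewrite -[X in _ --> X]subr0.
apply: cvgB; first exact: cvg_cst.
have sum0 : \sum_(1 <= k < q.+1) 0 = 0 :> R by exact: big1_eq.
(* The limit is written as a sum of $q$ zeros, so that the window, of fixed length, can be treated
   term by term. *)
rewrite -[X in _ --> X]sum0.
apply: (cvg_big (@add_continuous R)) => k _.
under eq_fun do rewrite addnC.
have : g @ \oo --> (0 : R).
  rewrite /g; under eq_fun do under eq_bigr do rewrite -mulnA.
  by apply: prod_inv_lucas_cvg0; rewrite ?muln_gt0.
by rewrite -(cvg_shiftn k).
Qed.
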